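(* Let $A$ be an $N\times N$ real symmetric matrix, let $\lambda_1\in\mathbb{R}$ be the smallest eigenvalue of $A$, and let $\gamma>\max(0,-\lambda_1)$. Define $F_A:\mathbb{R}^N\to\mathbb{R}$ by $F_A(x)=\frac12\langle x,Ax\rangle+\frac{\gamma}{2}\|x\|^2-\gamma\|x\|$. Then the set of nonzero critical points of $F_A$ (points $x\neq 0$ with $\nabla F_A(x)=0$) is $$\Big\{x\in\mathbb{R}^N : Ax=\lambda x\text{ for some }\lambda\in\mathbb{R}\text{ with }\|x\|=\frac{\gamma}{\gamma+\lambda}\Big\},$$ and $$\min_{x\in\mathbb{R}^N}F_A(x)=-\frac{\gamma^2}{2(\gamma+\lambda_1)}.$$
   Context: $\langle\cdot,\cdot\rangle$ and $\|\cdot\|$ denote the Euclidean inner product and norm on $\mathbb{R}^N$. $F_A$ is differentiable at every $x\ne 0$. *)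

(* Defs.v *)
From mathcomp Require Import all_boot all_order all_algebra.
From mathcomp Require Import all_classical all_reals all_analysis.

Set Implicit Arguments.
Unset Strict Implicit.
Unset Printing Implicit Defensive.

Import Order.TTheory GRing.Theory Num.Theory.
Import numFieldNormedType.Exports.

Local Open Scope classical_set_scope.
Local Open Scope ring_scope.

Definition dotv (R : realType) (N : nat) (x y : 'cV[R]_N) : R :=
  \sum_(i < N) x i ord0 * y i ord0.

(* The norm [`|x|] of MathComp-Analysis on matrices is the sup norm, hence this
   separate Euclidean norm. Both norms give the same topology on ['cV[R]_N],
   so [differentiable] below does not depend on the choice. *)
Definition norm2 (R : realType) (N : nat) (x : 'cV[R]_N) : R :=
  Num.sqrt (dotv x x).

(* [eigenvalue A a] speaks of row vectors, [v *m A = a *: v]; this defines the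
   same eigenvalues as [A *m x = a *: x], clearly so for symmetric [A]. *)
Definition smallest_eigenvalue (R : realType) (N : nat) (A : 'M[R]_N) (l : R)
    : Prop :=
  eigenvalue A l /\ (forall a : R, eigenvalue A a -> l <= a).

Definition gradient (R : realType) (N : nat) (f : 'cV[R]_N -> R) (x : 'cV[R]_N)
    : 'cV[R]_N :=
  \col_(i < N) 'D_(delta_mx i ord0) f x.

(* Differentiability is required explicitly because ['D_v f x] is a total
   operator, with an arbitrary value where the derivative does not exist. *)
Definition critical_point (R : realType) (N : nat) (f : 'cV[R]_N -> R)
    (x : 'cV[R]_N) : Prop :=
  differentiable f x /\ gradient f x = 0.

Definition F_ (R : realType) (N : nat) (A : 'M[R]_N) (gamma : R)
    (x : 'cV[R]_N) : R :=
  2^-1 * dotv x (A *m x) + gamma / 2 * norm2 x ^+ 2 - gamma * norm2 x.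

Definition is_minimum_value (R : realType) (T : Type) (f : T -> R) (m : R)
    : Prop :=
  range f m /\ lbound (range f) m.

(* Main.v *)
Require Import Defs.
From mathcomp Require Import all_boot all_order all_algebra.
From mathcomp Require Import all_classical all_reals all_analysis.
From mathcomp Require Import ring lra.

Import Order.TTheory GRing.Theory Num.Theory.
Import numFieldNormedType.Exports.

Local Open Scope classical_set_scope.
Local Open Scope ring_scope.

(** Away from the origin the gradient of [F_A] is [A x + (gamma - gamma / |x|) x].
    Hence a critical point is exactly an eigenvector for the eigenvalue
    [l = gamma / |x| - gamma]; solving this equation for [|x|] gives the
    condition [|x| = gamma / (gamma + l)] ([is_diff_F], [critical_pointE]).

    For the minimum, the Rayleigh inequality [lambda1 |x|^2 <= <x, A x>]
    ([rayleigh_ge]) bounds [F_A x] from below by a quadratic polynomial in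
    [|x|], namely [(gamma + lambda1) / 2 * |x|^2 - gamma |x|]. Completing the
    square gives the claimed value ([F_lower_bound]), which is attained at an
    eigenvector for [lambda1] of length [gamma / (gamma + lambda1)].

    The Rayleigh inequality is proved without diagonalising [A]. The quadratic
    form attains its minimum [m] on the compact unit sphere, at some [u]. Then
    [A - m] is positive semidefinite and its form vanishes at [u], which
    forces [(A - m) u = 0] ([psd_isotropic]). Thus [m] is an eigenvalue, and
    so [lambda1 <= m]. *)

(** * Euclidean inner product and norm *)

Lemma dotvE {R : realType} {N : nat} (x y : 'cV[R]_N) :
  dotv x y = (x^T *m y) ord0 ord0.
Proof. by rewrite /dotv mxE; apply: eq_bigr => i _; rewrite mxE. Qed.

Lemma dotvC {R : realType} {N : nat} (x y : 'cV[R]_N) : dotv x y = dotv y x.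
Proof. by apply: eq_bigr => i _; rewrite mulrC. Qed.

Lemma dotvDr {R : realType} {N : nat} (x y z : 'cV[R]_N) :
  dotv x (y + z) = dotv x y + dotv x z.
Proof. by rewrite !dotvE mulmxDr mxE. Qed.

Lemma dotvZr {R : realType} {N : nat} (a : R) (x y : 'cV[R]_N) :
  dotv x (a *: y) = a * dotv x y.
Proof. by rewrite !dotvE -scalemxAr mxE. Qed.

Lemma dotvDl {R : realType} {N : nat} (x y z : 'cV[R]_N) :
  dotv (x + y) z = dotv x z + dotv y z.
Proof. by rewrite dotvC dotvDr !(dotvC z). Qed.

Lemma dotvZl {R : realType} {N : nat} (a : R) (x y : 'cV[R]_N) :
  dotv (a *: x) y = a * dotv x y.
Proof. by rewrite dotvC dotvZr dotvC. Qed.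

Lemma dotv_delta {R : realType} {N : nat} (x : 'cV[R]_N) (i : 'I_N) :
  dotv x (delta_mx i ord0) = x i ord0.
Proof.
rewrite /dotv (bigD1 i)//= mxE !eqxx mulr1 big1 ?addr0// => j ji.
by rewrite mxE (negbTE ji) mulr0.
Qed.

Lemma dotv_sym {R : realType} {N : nat} (M : 'M[R]_N) (x y : 'cV[R]_N) :
  M^T = M -> dotv x (M *m y) = dotv (M *m x) y.
Proof. by move=> MT; rewrite !dotvE trmx_mul MT mulmxA. Qed.

Lemma dotv_ge0 {R : realType} {N : nat} (x : 'cV[R]_N) : 0 <= dotv x x.
Proof. by apply: sumr_ge0 => i _; rewrite -expr2 sqr_ge0. Qed.

Lemma dotv_eq0 {R : realType} {N : nat} (x : 'cV[R]_N) :
  (dotv x x == 0) = (x == 0).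
Proof.
apply/eqP/eqP => [/psumr_eq0P x0|->]; last by apply: big1 => i _; rewrite mxE mul0r.
apply/colP => i; rewrite mxE; apply/eqP; rewrite -sqrf_eq0 expr2.
by rewrite x0// => j _; rewrite -expr2 sqr_ge0.
Qed.

Lemma norm2_sqr {R : realType} {N : nat} (x : 'cV[R]_N) :
  norm2 x ^+ 2 = dotv x x.
Proof. by rewrite sqr_sqrtr ?dotv_ge0. Qed.

Lemma norm2_ge0 {R : realType} {N : nat} (x : 'cV[R]_N) : 0 <= norm2 x.
Proof. exact: sqrtr_ge0. Qed.

Lemma norm2_eq0 {R : realType} {N : nat} (x : 'cV[R]_N) :
  (norm2 x == 0) = (x == 0).
Proof. by rewrite -dotv_eq0 -norm2_sqr sqrf_eq0. Qed.

Lemma norm2Z {R : realType} {N : nat} (a : R) (x : 'cV[R]_N) :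
  norm2 (a *: x) = `|a| * norm2 x.
Proof.
by rewrite /norm2 dotvZl dotvZr mulrA -expr2 sqrtrM ?sqr_ge0// sqrtr_sqr.
Qed.

(** * Differentials of quadratic forms and of the norm *)

Lemma is_diff_sum {R : numFieldType} {V W : normedModType R} (n : nat)
    (f df : 'I_n -> V -> W) (x : V) :
  (forall i, is_diff x (f i) (df i)) ->
  is_diff x (fun y => \sum_(i < n) f i y) (fun v => \sum_(i < n) df i v).
Proof.
move=> h.
rewrite (_ : (fun y => _) = \sum_i f i); last by apply/funext => y; rewrite fct_sumE.
rewrite (_ : (fun v => _) = \sum_i df i); last by apply/funext => y; rewrite fct_sumE.
elim/big_ind2 : _ => //; first exact: is_diff_cst.
by move=> *; exact: is_diffD.
Qed.

Lemma is_diff_coord {R : realType} m n (M : 'M[R]_(m, n)) i j :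
  is_diff M (fun A : 'M[R]_(m, n) => A i j) (fun A : 'M[R]_(m, n) => A i j).
Proof.
have @f : {linear 'M[R]_(m, n) -> R}.
  by exists (fun A : 'M[R]_(m, n) => A i j); do 2![eexists]; do ?[constructor];
     rewrite ?mxE// => ? *; rewrite ?mxE//; move=> ?; rewrite !mxE.
apply: DiffDef; first exact: differentiable_coord.
by rewrite (@diff_lin _ _ _ f)//; exact: coord_continuous.
Qed.

(** The vector argument is composed with a map [f] so that the same lemma serves
    for column vectors ([f] the identity), where [F_A] lives, and for row
    vectors ([f] the transposition), where the Rayleigh quotient is minimised. *)
Lemma is_diff_quadratic {R : realType} {V : normedModType R} {N : nat}
    (M : 'M[R]_N) (f df : V -> 'cV[R]_N) (x : V) :
  (forall i, is_diff x (fun y => f y i ord0) (fun v => df v i ord0)) ->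
  is_diff x (fun y => dotv (f y) (M *m f y))
    (fun v => dotv (df v) (M *m f x) + dotv (f x) (M *m df v)).
Proof.
move=> h.
have hM i : is_diff x (fun y => (M *m f y) i ord0) (fun v => (M *m df v) i ord0).
  have E (g : V -> 'cV[R]_N) :
      (fun y => (M *m g y) i ord0) = (fun y => \sum_j M i j * g y j ord0).
    by apply/funext => y; rewrite mxE.
  by rewrite !E; apply: is_diff_sum.
apply: (is_diff_eq (is_diff_sum _ _ _ _ (fun i => is_diffM (h i) (hM i)))).
apply/funext => v; rewrite /dotv -big_split; apply: eq_bigr => i _ /=.
by rewrite fctE [RHS]addrC [df v i _ * _]mulrC.
Qed.

Lemma is_diff_quadratic_id {R : realType} {N : nat} (M : 'M[R]_N) (x : 'cV[R]_N) :
  M^T = M ->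
  is_diff x (fun y : 'cV[R]_N => dotv y (M *m y)) (fun v => 2 * dotv (M *m x) v).
Proof.
move=> MT; have D := is_diff_quadratic M id id x (fun i => is_diff_coord _ _ x i ord0).
apply: (is_diff_eq D).
by apply/funext => v /=; rewrite (dotv_sym _ x v)// (dotvC v); ring.
Qed.

Lemma is_diff_norm2 {R : realType} {N : nat} (x : 'cV[R]_N) : x != 0 ->
  is_diff x (@norm2 R N) (fun v => (norm2 x)^-1 * dotv x v).
Proof.
move=> x0.
have sx : 0 < dotv x x by rewrite lt_def dotv_eq0 x0 dotv_ge0.
have dsq : is_diff x (fun y : 'cV[R]_N => dotv y y) (fun v => 2 * dotv x v).
  have := is_diff_quadratic_id 1%:M x (trmx1 _ _); rewrite mul1mx.
  by under eq_fun do rewrite mul1mx.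
have dsqrt : is_diff (dotv x x) (@Num.sqrt R) (fun h => h * (2 * norm2 x)^-1).
  have hd := is_derive1_sqrt sx.
  have df : differentiable (@Num.sqrt R) (dotv x x) by apply/derivable1_diffP.
  by apply: DiffDef => //; rewrite diff1E// derive1E derive_val.
apply: (is_diff_eq (is_diff_comp dsq dsqrt)).
apply/funext => v /=; field.
by rewrite norm2_eq0.
Qed.

(** * Critical points *)

Lemma is_diff_F {R : realType} {N : nat} (A : 'M[R]_N) (gamma : R) (x : 'cV[R]_N) :
  A^T = A -> x != 0 ->
  is_diff x (F_ A gamma)
    (dotv (A *m x + (gamma - gamma / norm2 x) *: x)).
Proof.
move=> AT x0.
have dA := is_diff_quadratic_id A x AT.
have dn := is_diff_norm2 x x0.
have D := is_diffB (is_diffD (is_diffZ 2^-1 dA) (is_diffZ (gamma / 2) (is_diffX 1 dn)))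
  (is_diffZ gamma dn).
apply: (is_diff_eq D); apply/funext => v /=.
rewrite !fctE dotvDl dotvZl.
have n0 : norm2 x != 0 by rewrite norm2_eq0.
by rewrite /GRing.scale/=; field.
Qed.

Lemma critical_pointE {R : realType} {N : nat} (A : 'M[R]_N) (gamma : R)
    (x : 'cV[R]_N) :
  A^T = A -> x != 0 ->
  critical_point (F_ A gamma) x <-> A *m x = (gamma / norm2 x - gamma) *: x.
Proof.
move=> AT x0; have dF := is_diff_F A gamma x AT x0.
have -> : critical_point (F_ A gamma) x <-> gradient (F_ A gamma) x = 0.
  by split => [[]//|g0]; split => //; exact: ex_diff.
have -> : gradient (F_ A gamma) x = A *m x + (gamma - gamma / norm2 x) *: x.
  apply/colP => i; rewrite mxE deriveE; last exact: ex_diff.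
  by rewrite diff_val dotv_delta.
by rewrite -[gamma / _ - _]opprB scaleNr; split => [/eqP|->]; rewrite ?addNr// addr_eq0 => /eqP.
Qed.

(** * The Rayleigh inequality and the minimum *)

(** At a zero [x] of a nonnegative quadratic form, the first-order term in every
    direction must vanish. It is enough to move along [- M x] itself: the form
    then changes by [- 2 s |M x|^2 + O(s^2)], which is negative for small
    [s > 0] unless [M x = 0]. *)
Lemma psd_isotropic {R : realType} {N : nat} (M : 'M[R]_N) (x : 'cV[R]_N) :
  M^T = M -> (forall y, 0 <= dotv y (M *m y)) -> dotv x (M *m x) = 0 ->
  M *m x = 0.
Proof.
move=> MT M0 x0; apply/eqP; rewrite -dotv_eq0.
set w := M *m x in x0 *.
have c0 := M0 w; set c := dotv w (M *m w) in c0.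
have W0 := dotv_ge0 w; set W := dotv w w in W0 *.
have expand t : dotv (x + t *: w) (M *m (x + t *: w)) = t * (2 * W + t * c).
  rewrite mulmxDr -scalemxAr !(dotvDl, dotvDr, dotvZl, dotvZr).
  by rewrite (dotv_sym _ x w)// -/w x0 -/W -/c; ring.
(* With the step [- W / (c + 1)] along [w], the quadratic term is at most half
   of the linear one, so the form becomes negative as soon as [W > 0]. Adding
   1 avoids a separate case for [c = 0]. *)
have d0 : 0 < (c + 1)^-1 by rewrite invr_gt0 ltr_wpDl.
have dc : (c + 1)^-1 * c = 1 - (c + 1)^-1 by field; apply/eqP; lra.
have := M0 (x + (- ((c + 1)^-1 * W)) *: w); rewrite expand.
move: d0 dc; set d := _^-1 => d0 dc.
have -> : - (d * W) * (2 * W + - (d * W) * c) = - (W ^+ 2 * (d * (1 + d))).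
  transitivity (- (W ^+ 2 * (d * (2 - d * c)))); first by ring.
  by rewrite dc; ring.
rewrite oppr_ge0 pmulr_lle0; last by rewrite mulr_gt0// addr_gt0.
by rewrite -sqrf_eq0 eq_le sqr_ge0 => ->.
Qed.

(** Minimisation over the unit sphere [S] replaces the spectral theorem: the
    minimiser is an eigenvector, and homogeneity extends the bound from [S] to
    all vectors. Row vectors are used because eigenvectors are rows in
    [eigenvalue]. *)
Lemma rayleigh_ge {R : realType} {N : nat} (A : 'M[R]_N) (l : R) (x : 'cV[R]_N) :
  A^T = A -> smallest_eigenvalue A l -> l * dotv x x <= dotv x (A *m x).
Proof.
move=> AT [/eigenvalueP[v vA v0] lmin].
pose q (M : 'M[R]_N) (u : 'rV[R]_N) := dotv u^T (M *m u^T).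
have q_cont M : continuous (q M).
  move=> u; apply: differentiable_continuous.
  suff D i : is_diff u (fun y : 'rV[R]_N => y^T i ord0) (fun y => y^T i ord0).
    have Dq := is_diff_quadratic M trmx trmx u D.
    by case: Dq.
  rewrite (_ : (fun y => _) = (fun y : 'rV[R]_N => y ord0 i)); last first.
    by apply/funext => y; rewrite mxE.
  exact: is_diff_coord.
pose S := [set u : 'rV[R]_N | q 1%:M u = 1].
have SE u : S u = (dotv u^T u^T = 1) by rewrite /S/= /q mul1mx.
have S_compact : compact S.
  apply: bounded_closed_compact.
    exists 1; split => // M M1 u; rewrite SE => u1.
    (* The norm is here the sup norm: each squared entry is one term of the sum
       of squares, which is 1. *)
    apply: le_trans (ltW M1); rewrite [leLHS]mx_normrE.
    apply: bigmax_le => // -[i j] _ /=; rewrite (ord1 i).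
    rewrite -(@ler_pXn2r _ 2)// ?nnegrE// expr1n -u1 /dotv (bigD1 j)//= !mxE.
    rewrite real_normK ?num_real// expr2 lerDl.
    by apply: sumr_ge0 => k _; rewrite -expr2 sqr_ge0.
  have -> : S = q 1%:M @^-1` [set 1] by [].
  by apply: closed_comp => // u _; exact: q_cont.
have nS (y : 'cV[R]_N) : y != 0 -> S ((norm2 y)^-1 *: y)^T.
  move=> y0; rewrite SE trmxK dotvZl dotvZr -norm2_sqr.
  by field; rewrite norm2_eq0.
have [u] : exists2 c, c \in S & forall t, t \in S -> q A c <= q A t.
  apply: EVT_min_rV => //; last by apply: continuous_subspaceT; exact: q_cont.
  by exists ((norm2 v^T)^-1 *: v^T)^T; apply: nS; rewrite -trmx0 (inj_eq trmx_inj).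
rewrite inE SE => u1 umin.
set m := q A u in umin.
have le_m (y : 'cV[R]_N) : m * dotv y y <= dotv y (A *m y).
  have [->|y0] := eqVneq y 0; first by rewrite mulmx0 !dotvE mulmx0 mxE mulr0.
  have := umin _ (mem_set (nS _ y0)).
  rewrite /q trmxK -scalemxAr dotvZl dotvZr mulrA -expr2 exprVn norm2_sqr.
  by rewrite mulrC ler_pdivlMr// lt_def dotv_eq0 y0 dotv_ge0.
have eqm : (A - m%:M) *m u^T = 0.
  have E y : dotv y ((A - m%:M) *m y) = dotv y (A *m y) - m * dotv y y.
    by rewrite mulmxBl mul_scalar_mx -scaleNr dotvDr dotvZr mulNr.
  apply: psd_isotropic.
  - by rewrite linearB/= AT tr_scalar_mx.
  - by move=> y; rewrite E subr_ge0.
  - by rewrite E u1 mulr1 subrr.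
apply: le_trans (le_m x); apply: ler_wpM2r; first exact: dotv_ge0.
apply: lmin; apply/eigenvalueP; exists u; last first.
  by apply/eqP => u0; move: u1 (oner_neq0 R) => <-; rewrite u0 trmx0 dotvE mulmx0 mxE eqxx.
apply: trmx_inj; rewrite trmx_mul AT linearZ/=.
by apply/eqP; rewrite -subr_eq0 -mul_scalar_mx -mulmxBl eqm.
Qed.

Lemma F_eigen {R : realType} {N : nat} (A : 'M[R]_N) (gamma l : R) (x : 'cV[R]_N) :
  A *m x = l *: x ->
  F_ A gamma x = 2^-1 * (gamma + l) * norm2 x ^+ 2 - gamma * norm2 x.
Proof.
by move=> Ax; rewrite /F_ Ax dotvZr -norm2_sqr; field.
Qed.

(** After the Rayleigh inequality, what remains is the square
    [((gamma + l) |x| - gamma)^2 / (2 (gamma + l))]. *)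
Lemma F_lower_bound {R : realType} {N : nat} (A : 'M[R]_N) (gamma l : R) (x : 'cV[R]_N) :
  A^T = A -> smallest_eigenvalue A l -> 0 < gamma + l ->
  - (gamma ^+ 2 / (2 * (gamma + l))) <= F_ A gamma x.
Proof.
move=> AT lmin gl; have := rayleigh_ge A l x AT lmin; rewrite /F_ -norm2_sqr.
set r := norm2 x; set q := dotv _ _ => lq.
rewrite -subr_ge0.
have : 0 <= 2^-1 * (q - l * r ^+ 2) + ((gamma + l) * r - gamma) ^+ 2 / (2 * (gamma + l)).
  apply: addr_ge0; first by apply: mulr_ge0; rewrite ?subr_ge0 ?invr_ge0.
  by apply: divr_ge0; rewrite ?sqr_ge0// mulr_ge0// ltW.
congr (0 <= _); field.
by apply/eqP; lra.
Qed.

(* In the second set, [gamma + l != 0] says that the quotient is meaningful: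
   since [gamma / 0 = 0] in MathComp, [x = 0], [l = - gamma] would otherwise
   satisfy the other two conditions. *)
Theorem lemma1 (R : realType) (N : nat) (A : 'M[R]_N) (lambda1 gamma : R)
    (A_sym : A^T = A)
    (lambda1_min : smallest_eigenvalue A lambda1)
    (gamma_gt : Num.max 0 (- lambda1) < gamma) :
  [set x : 'cV[R]_N | x != 0 /\ critical_point (F_ A gamma) x] =
  [set x : 'cV[R]_N | exists l : R,
     [/\ A *m x = l *: x, gamma + l != 0 & norm2 x = gamma / (gamma + l)]]
  /\
  is_minimum_value (F_ A gamma) (- (gamma ^+ 2 / (2 * (gamma + lambda1)))).
Proof.
move: gamma_gt; rewrite gt_max => /andP[g0 gl].
have gl0 : 0 < gamma + lambda1 by lra.
have gn0 : gamma != 0 by rewrite gt_eqF.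
split.
  apply/seteqP; split => x /=.
    move=> [x0 /(critical_pointE A gamma x A_sym x0) Ax].
    have n0 : norm2 x != 0 by rewrite norm2_eq0.
    have gE : gamma + (gamma / norm2 x - gamma) = gamma / norm2 x.
      by rewrite addrC subrK.
    exists (gamma / norm2 x - gamma); rewrite gE; split => //.
      by rewrite mulf_neq0 ?invr_eq0.
    by rewrite invf_div mulrC divfK.
  move=> [l [Ax gln0 nx]].
  have x0 : x != 0 by rewrite -norm2_eq0 nx mulf_neq0 ?invr_eq0.
  split => //; apply/(critical_pointE A gamma x A_sym x0).
  by rewrite Ax nx invf_div mulrC divfK// addrAC subrr add0r.
split; last by move=> _ [x _ <-]; exact: F_lower_bound.
have [/eigenvalueP[v vA v0] _] := lambda1_min.
have vT0 : norm2 v^T != 0 by rewrite norm2_eq0 -trmx0 (inj_eq trmx_inj).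
have r0 : 0 < gamma / (gamma + lambda1) by rewrite divr_gt0.
(* The critical radius for [lambda1], where the completed square vanishes. *)
exists ((gamma / (gamma + lambda1) / norm2 v^T) *: v^T) => //.
rewrite (@F_eigen _ _ _ _ lambda1); last first.
  by rewrite -scalemxAr -[in LHS]A_sym -trmx_mul vA linearZ/= !scalerA mulrC.
rewrite norm2Z ger0_norm ?divfK//; last by rewrite divr_ge0 ?norm2_ge0 ?ltW.
by field; rewrite gt_eqF.
Qed.
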